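(* Let $G$ be a group, $\alpha$ an endomorphism of $G$, and $S=BR(G,\alpha)$. Let $N$ be an $\alpha$-invariant normal subgroup of $G$, $z\in G$, and $k\geq 1$ an integer such that $N(z\alpha)=Nz$ and $g^{-1}(Nz)(g\alpha^k)=Nz$ for all $g\in G$, and let $\varepsilon=\varepsilon_{(N,z,k)}$ be the corresponding group congruence on $S$. Then $\varepsilon$ is perfect if and only if for all integers $n\geq 1$ and all $x\in G$, $G\alpha^n\cap Nx\neq\emptyset$.
   Context: $\mathbb{N}$ denotes the set of all nonnegative integers. Mappings are written on the right and composed left to right. For a group $G$ and an endomorphism $\alpha$ of $G$, the Bruck–Reilly extension $BR(G,\alpha)$ is the set $\mathbb{N}\times G\times\mathbb{N}$ with multiplication $(m,g,n)(p,h,q)=(m+p-r,\,(g\alpha^{p-r})(h\alpha^{n-r}),\,n+q-r)$, where $r=\min\{n,p\}$ and $\alpha^0$ is the identity automorphism of $G$. It is an inverse semigroup with identity $(0,e_G,0)$ (where $e_G$ is the identity of $G$), with idempotents $(n,e_G,n)$, $n\in\mathbb{N}$, and with inverses $(m,g,n)^{-1}=(n,g^{-1},m)$. For a congruence $\varepsilon$ on a semigroup $S$ and $x\in S$, $x\varepsilon$ denotes the $\varepsilon$-class of $x$. For $A,B\subseteq S$, $AB=\{ab:a\in A,\ b\in B\}$. The congruence $\varepsilon$ is perfect if $(x\varepsilon)(y\varepsilon)=(xy)\varepsilon$ (equality of subsets of $S$) for all $x,y\in S$. It is a group congruence if $S/\varepsilon$ is a group. A subgroup $N$ of $G$ is $\alpha$-invariant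 if $N\alpha^{-1}=N$, where $N\alpha^{-1}=\{g\in G: g\alpha\in N\}$. For an $\alpha$-invariant normal subgroup $N$ of $G$, $z\in G$ and $k\geq 1$ such that $N(z\alpha)=Nz$ and $g^{-1}(Nz)(g\alpha^k)=Nz$ for all $g\in G$, put $U(N,z,k)=\{(m,g,n)\in S: m\equiv n\ (\mathrm{mod}\ k)\text{ and }g\in Nz^l\text{ where }l=(n-m)/k\}$, with $S=BR(G,\alpha)$. Then $\varepsilon_{(N,z,k)}=\{(x,y)\in S\times S: xy^{-1}\in U(N,z,k)\}$, which is known to be a group congruence on $S$ having $U(N,z,k)$ as the identity element of the quotient. *)

(* Defs.v *)
From HB Require Import structures.
From mathcomp Require Import all_boot all_order all_algebra.
From mathcomp Require Import classical_sets.
From mathcomp Require Import zify.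

Set Implicit Arguments.
Unset Strict Implicit.
Unset Printing Implicit Defensive.

Local Open Scope group_scope.
Local Open Scope classical_set_scope.

(* Mappings are written on the left here, so g alpha^n is iter n alpha g, and
   N alpha^-1 is alpha @^-1` N. *)
Notation endomorphism G := (UMagmaMorphism.type G G).

Section IterMorphism.
Variables (G : groupType) (alpha : endomorphism G).

Lemma iter_gmulf1 n : iter n alpha 1 = 1.
Proof. by elim: n => //= n ->; rewrite gmulf1. Qed.

Lemma iter_gmulfM n : {morph iter n alpha : x y / x * y}.
Proof. by move=> x y; elim: n => //= n ->; rewrite gmulfM. Qed.

Lemma iter_gmulfV n : {morph iter n alpha : x / x^-1}.
Proof. by move=> x; elim: n => //= n ->; rewrite gmulfV. Qed.

End IterMorphism.

Definition BR (G : groupType) (alpha : endomorphism G) : Type :=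
  (nat * G * nat)%type.

HB.instance Definition _ (G : groupType) (alpha : endomorphism G) :=
  Choice.copy (BR alpha) (nat * G * nat)%type.

Section BruckReilly.
Variables (G : groupType) (alpha : endomorphism G).

Definition BR_one : BR alpha := (0, 1, 0).

(* The differences are truncated subtractions of natural numbers, but none of
   them truncates because r is at most n and at most p. *)
Definition BR_mul (x y : BR alpha) : BR alpha :=
  let: (m, g, n) := x in
  let: (p, h, q) := y in
  let r := minn n p in
  ((m + p - r)%N, iter (p - r) alpha g * iter (n - r) alpha h, (n + q - r)%N).

Definition BR_inv (x : BR alpha) : BR alpha :=
  let: (m, g, n) := x in (n, g^-1, m).

Lemma BR_mulA : associative BR_mul.
Proof.
move=> [[m g] n] [[p h] q] [[s k] t]; rewrite /BR_mul.
rewrite !iter_gmulfM -!iterD mulgA.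
congr (_, _ * _ * _, _); try lia; congr (iter _ alpha _); lia.
Qed.

Lemma BR_mul1 : left_id BR_one BR_mul.
Proof.
by move=> [[m g] n]; rewrite /BR_mul /= min0n !subn0 add0n iter_gmulf1 mul1g.
Qed.

Lemma BR_invK : involutive BR_inv.
Proof. by move=> [[m g] n]; rewrite /BR_inv invgK. Qed.

Lemma BR_invM : {morph BR_inv : x y / BR_mul x y >-> BR_mul y x}.
Proof.
move=> [[m g] n] [[p h] q]; rewrite /BR_inv /BR_mul.
by rewrite invgM !iter_gmulfV minnC (addnC n q) (addnC m p).
Qed.

HB.instance Definition _ :=
  isStarMonoid.Build (BR alpha) BR_mulA BR_mul1 BR_invK BR_invM.

End BruckReilly.

Definition setmul (S : magmaType) (A B : set S) : set S :=
  [set a * b | a in A & b in B].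

Definition eqclass (S : Type) (e : S -> S -> Prop) (x : S) : set S :=
  [set y | e x y].

Definition perfect (S : semigroupType) (e : S -> S -> Prop) : Prop :=
  forall x y : S, setmul (eqclass e x) (eqclass e y) = eqclass e (x * y).

Section Subgroups.
Variable G : groupType.
Implicit Type N : set G.

Definition normal_subgroup N : Prop :=
  group_closed (mem N) /\ (forall a g : G, N a -> N (a ^ g)).

Definition invariant_subgroup (alpha : endomorphism G) N : Prop :=
  alpha @^-1` N = N.

Definition right_coset N (x : G) : set G := [set a * x | a in N].

Definition expgz (x : G) (l : int) : G :=
  match l with Posz n => x ^+ n | Negz n => x ^- n.+1 end.

End Subgroups.

Section GroupCongruence.
Variables (G : groupType) (alpha : endomorphism G).
Variables (N : set G) (z : G) (k : nat).

(* The quotient of integers is exact here, by the congruence modulo k. *)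
Definition U : set (BR alpha) :=
  [set x : BR alpha | let: (m, g, n) := x in
     m = n %[mod k] /\
     right_coset N (expgz z ((n%:Z - m%:Z)%R %/ k%:Z)%Z) g].

Definition eps (x y : BR alpha) : Prop := U (x / y).

End GroupCongruence.

Arguments U [G] alpha N z k.
Arguments eps [G] alpha N z k x y.

(* Main.v *)
Require Import Defs.
From mathcomp Require Import all_boot all_order all_algebra.
From mathcomp Require Import classical_sets.
From mathcomp Require Import zify.

Set Implicit Arguments.
Unset Strict Implicit.

Local Open Scope group_scope.
Local Open Scope classical_set_scope.

(** Both sides of the equivalence hold for every triple (N, z, k) satisfying
    the hypotheses; the proof establishes each of them separately.

    Invariance of N makes alpha an injective endomorphism of G/N, the condition
    N (z alpha) = N z says that it fixes the image of z, and the conjugation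
    condition says that its k-th power is the inner automorphism
    g |-> z^-1 g z.  Iterating, z^l alpha^m(g) and alpha^n(g) z^l have the same
    image whenever m = n + k l ([coset_swap]).

    The right-hand side follows at once ([iter_meets_coset]): since alpha^(k n)
    is inner on G/N, it is onto modulo N, and hence so is alpha^n.

    For the left-hand side, the congruence has a description free of truncated
    subtractions ([epsE]): (m, g, n) and (p, h, q) are related iff
    n + p = m + q + k l for some integer l such that alpha^q(g) and
    z^l alpha^n(h) agree modulo N.  With it and [coset_swap], one checks that if
    x and a are related, then x y and a b are related iff y and b are
    ([eps_mul2]); in one direction this is compatibility with products, in the
    other it is left cancellation in the quotient.  Moreover every class
    contains an element with any prescribed first coordinate
    ([eps_representative]).  So given w = (i, f, j) related to x y, pick
    a = (i, c, s) related to x; then w = a b with b = (s, c^-1 f, j), and b is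
    related to y by cancellation ([perfect_eps]). *)

(** * Integer powers and cosets of a normal subgroup *)

Lemma expgzB (G : groupType) (x : G) (a b : nat) :
  expgz x (a%:Z - b%:Z)%R = x ^+ a / x ^+ b.
Proof.
case: (leqP b a) => ba.
  have -> : (a%:Z - b%:Z)%R = Posz (a - b) by lia.
  by rewrite /= expgnFr.
have -> : (a%:Z - b%:Z)%R = Negz (b - a).-1 by lia.
by rewrite /= prednK ?subn_gt0 // expgnFr 1?ltnW // invgM invgK.
Qed.

Lemma expgzD (G : groupType) (x : G) (l l' : int) :
  expgz x (l + l')%R = expgz x l * expgz x l'.
Proof.
have diff (i : int) : exists a b : nat, i = (a%:Z - b%:Z)%R.
  by case: i => n; [exists n, 0%N | exists 0%N, n.+1]; lia.
have [[a [b ->]] [c [d ->]]] := (diff l, diff l').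
have -> : (a%:Z - b%:Z + (c%:Z - d%:Z))%R = (Posz (a + c) - Posz (d + b))%R.
  by lia.
rewrite !expgzB !expgnDr invgM !mulgA; congr (_ / _).
have xbc : commute (x ^+ c) (x ^- b) by apply/commuteV/commuteX2.
by rewrite -!mulgA xbc.
Qed.

Lemma expgzN (G : groupType) (x : G) (l : int) :
  expgz x (- l)%R = (expgz x l)^-1.
Proof.
by apply: (mulgI (expgz x l)); rewrite -expgzD GRing.addrN mulgV.
Qed.

Section Cosets.

Variables (G : groupType) (N : set G).
Hypothesis N_normal : normal_subgroup N.

Local Notation cl := (right_coset N).

Lemma right_cosetE x y : cl x y <-> N (y / x).
Proof.
split; first by case=> a Na <-; rewrite mulgK.
by move=> Nyx; exists (y / x); rewrite // mulgVK.
Qed.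

Lemma normal_subgroup1 : N 1.
Proof. by have [[]] := N_normal; rewrite inE. Qed.

Lemma normal_subgroupF a b : N a -> N b -> N (a / b).
Proof.
by have [[_ /(_ a b)]] := N_normal; rewrite !inE => NF _ Na; apply: NF.
Qed.

Lemma normal_subgroupV a : N a -> N a^-1.
Proof.
by move=> Na; rewrite -div1g; apply: normal_subgroupF normal_subgroup1 Na.
Qed.

Lemma normal_subgroupM a b : N a -> N b -> N (a * b).
Proof.
by move=> Na /normal_subgroupV Nb; rewrite -[b]invgK; apply: normal_subgroupF.
Qed.

Lemma coset_eqE x y : cl x = cl y <-> N (x / y).
Proof.
split=> [xy | Nxy].
  apply/right_cosetE; rewrite -xy; apply/right_cosetE; rewrite mulgV.
  exact: normal_subgroup1.
apply/seteqP; split=> u /right_cosetE Nu; apply/right_cosetE.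
  by rewrite -(divgKA x); apply: normal_subgroupM.
by rewrite -(mulgKA y^-1); apply: normal_subgroupF.
Qed.

Lemma right_coset_eq x y : cl x y <-> cl y = cl x.
Proof. by rewrite right_cosetE coset_eqE. Qed.

(** Elements of G/N are handled as the sets [cl x] themselves, so that a
    congruence modulo N is an equality and can be rewritten with inside a
    product by splitting the product with this lemma. *)
Lemma right_cosetM x y : cl (x * y) = setmul (cl x) (cl y).
Proof.
have [_ NJ] := N_normal.
apply/seteqP; split=> u.
  case=> a Na <-; rewrite mulgA.
  exists (a * x); first by exists a.
  by exists y => //; exists 1; [exact: normal_subgroup1 | rewrite mul1g].
case=> _ [a Na <-] [_ [b Nb <-] <-]; apply/right_cosetE.
have := normal_subgroupM Na (NJ _ x^-1 Nb).
by rewrite /conjg invgK invgM !mulgA mulgK.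
Qed.

Lemma right_coset_mulI a x y : cl (a * x) = cl (a * y) <-> cl x = cl y.
Proof.
split=> axy; last by rewrite !right_cosetM axy.
by rewrite -(mulKg a x) right_cosetM axy -right_cosetM mulKg.
Qed.

Lemma right_coset_mulIr a x y : cl (x * a) = cl (y * a) <-> cl x = cl y.
Proof. by rewrite !coset_eqE mulgKA. Qed.

End Cosets.

(** * The endomorphism induced on the quotient by N *)

Section GroupCongruence.

Variables (G : groupType) (alpha : endomorphism G).
Variables (N : set G) (z : G) (k : nat).
Hypotheses (N_normal : normal_subgroup N)
  (N_invariant : invariant_subgroup alpha N)
  (k_ge1 : (1 <= k)%N)
  (Nz_alpha : right_coset N (alpha z) = right_coset N z)
  (Nz_conj : forall g : G,
     [set g^-1 * u * iter k alpha g | u in right_coset N z]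
     = right_coset N z).

Local Notation cl := (right_coset N).

(** Invariance of N under preimages amounts to alpha being well defined and
    injective on the cosets. *)
Lemma coset_iterE n x y :
  cl (iter n alpha x) = cl (iter n alpha y) <-> cl x = cl y.
Proof.
rewrite !coset_eqE //.
rewrite -iter_gmulfV -iter_gmulfM; elim: n => //= n <-.
by rewrite -{2}N_invariant.
Qed.

Lemma coset_iter_fixed n l : cl (iter n alpha (expgz z l)) = cl (expgz z l).
Proof.
have powz a : cl (alpha (z ^+ a)) = cl (z ^+ a).
  elim: a => [|a IHa]; first by rewrite gmulf1.
  by rewrite expgS gmulfM !(right_cosetM N_normal) Nz_alpha IHa.
have fixz : cl (alpha (expgz z l)) = cl (expgz z l).
  case: l => a; first exact: powz.
  apply/(right_coset_mulI N_normal (z ^+ a.+1)).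
  by rewrite right_cosetM // -powz -right_cosetM // -gmulfM /= mulgV gmulf1.
elim: n => //= n IHn.
by rewrite -[in RHS]fixz; apply/(coset_iterE 1).
Qed.

Lemma coset_conj_iter g : cl (z * iter k alpha g) = cl (g * z).
Proof.
have Nzz : cl z z by apply/right_coset_eq.
have conj_z : cl (g^-1 * (z * iter k alpha g)) = cl z.
  apply/right_coset_eq => //; rewrite -(Nz_conj g).
  by exists z; rewrite // mulgA.
by rewrite -(mulVKg g (z * _)) right_cosetM // conj_z -right_cosetM.
Qed.

(** Moving z^l across an iterate of alpha changes the exponent of alpha by
    k l, because alpha^k is conjugation by z on G/N. *)
Lemma coset_swap m n l g : (m%:Z = n%:Z + k%:Z * l)%R ->
  cl (expgz z l * iter m alpha g) = cl (iter n alpha g * expgz z l).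
Proof.
have swapX a i h :
    cl (z ^+ a * iter (i + k * a) alpha h) = cl (iter i alpha h * z ^+ a).
  elim: a => [|a IHa]; first by rewrite muln0 addn0 mul1g mulg1.
  rewrite {1}expgSr -mulgA mulnS addnCA iterD right_cosetM //.
  rewrite coset_conj_iter -right_cosetM // mulgA right_cosetM // IHa.
  by rewrite -right_cosetM // -mulgA -expgSr.
case: l => a eq_mn /=.
  have -> : m = (n + k * a)%N by lia.
  exact: swapX.
have -> : n = (m + k * a.+1)%N by lia.
apply/(right_coset_mulI N_normal (z ^+ a.+1)); rewrite mulVKg mulgA.
by rewrite right_cosetM // swapX -right_cosetM // mulgK.
Qed.

(** * The congruence *)

(** Membership of (m, g, n) (p, h, q)^-1 in U compares alpha^(q - r)(g) with
    z^l alpha^(n - r)(h), r being the minimum of n and q.  Applying alpha^r,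
    which is injective on G/N and fixes the image of z, removes r. *)
Lemma epsE m g n p h q :
  eps alpha N z k (m, g, n) (p, h, q) <->
  exists2 l : int, (n%:Z + p%:Z = m%:Z + q%:Z + k%:Z * l)%R &
    cl (iter q alpha g) = cl (expgz z l * iter n alpha h).
Proof.
pose r := minn n q.
have eps_classes l :
  cl (iter (q - r) alpha g * iter (n - r) alpha h^-1) = cl (expgz z l) <->
  cl (iter q alpha g) = cl (expgz z l * iter n alpha h).
  rewrite iter_gmulfV -(right_coset_mulIr N_normal (iter (n - r) alpha h)).
  rewrite mulgVK -(coset_iterE r) iter_gmulfM -!iterD.
  rewrite (right_cosetM N_normal (iter r alpha _)) coset_iter_fixed.
  rewrite -right_cosetM //.
  by rewrite !subnKC // /r ?geq_minr ?geq_minl.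
rewrite /eps /U /= -/r.
split.
  case=> eq_mod /(right_coset_eq N_normal); set l := intdiv.divz _ _ => eq_cl.
  exists l; last by apply/eps_classes; rewrite eq_cl.
  have : (k%:Z * l = (n + p - r)%N%:Z - (m + q - r)%N%:Z)%R.
    rewrite GRing.mulrC intdiv.divzK //.
    by rewrite -intdiv.eqz_mod_dvd; apply/eqP; rewrite !intdiv.modz_nat eq_mod.
  rewrite /r; lia.
case=> l eq_l eq_cl.
have eq_kl : ((n + p - r)%N%:Z - (m + q - r)%N%:Z = l * k%:Z)%R.
  by rewrite /r; lia.
split.
  apply/eqP; rewrite -eqz_nat -!intdiv.modz_nat eq_sym intdiv.eqz_mod_dvd.
  by rewrite eq_kl intdiv.dvdz_mull.
apply/(right_coset_eq N_normal); rewrite eq_kl intdiv.mulzK; last by lia.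
by apply/eps_classes.
Qed.

(** Let l1 be the exponent of z relating x to a.  Then y is related to b with
    exponent l2 iff x y is related to a b with exponent l1 + l2: the factors
    coming from x and a cancel once z^l2 has been moved past the one from a. *)
Lemma eps_mul2 x a y b : eps alpha N z k x a ->
  eps alpha N z k (x * y) (a * b) <-> eps alpha N z k y b.
Proof.
move: x a y b => [[m g] n] [[i c] s] [[p h] q] [[u d] j].
case/epsE => l1 eq_l1 eq_gc.
pose r := minn n p; pose r' := minn s u.
have eq_classes l2 :
    (q%:Z + u%:Z = p%:Z + j%:Z + k%:Z * l2)%R ->
    cl (iter (s + j - r') alpha (iter (p - r) alpha g * iter (n - r) alpha h)) =
      cl (expgz z (l1 + l2)%R *
        iter (n + q - r) alpha (iter (u - r') alpha c * iter (s - r') alpha d))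
    <-> cl (iter j alpha h) = cl (expgz z l2 * iter q alpha d).
  move=> eq_l2.
  (* Applying alpha^(r + r') turns all exponents of alpha into plain sums. *)
  rewrite -(coset_iterE (r + r')) !iter_gmulfM.
  rewrite (right_cosetM N_normal (iter _ alpha (expgz _ _))) coset_iter_fixed.
  rewrite -right_cosetM // -!iterD.
  have -> : (r + r' + (s + j - r') + (p - r) = j + p + s)%N by lia.
  have -> : (r + r' + (s + j - r') + (n - r) = s + n + j)%N by lia.
  have -> : (r + r' + (n + q - r) + (u - r') = n + q + u)%N by lia.
  have -> : (r + r' + (n + q - r) + (s - r') = s + n + q)%N by lia.
  have eq_gc' : cl (iter (j + p + s) alpha g) =
      cl (expgz z l1 * iter (j + p + n) alpha c).
    rewrite !(iterD (j + p)) right_cosetM // -(coset_iter_fixed (j + p)).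
    by rewrite -right_cosetM // -iter_gmulfM; apply/coset_iterE.
  have eq_c : cl (expgz z l2 * iter (n + q + u) alpha c) =
      cl (iter (j + p + n) alpha c * expgz z l2).
    by apply: coset_swap; lia.
  rewrite (right_cosetM N_normal (iter _ alpha g)) eq_gc'.
  rewrite -right_cosetM // -mulgA expgzD -mulgA.
  rewrite right_coset_mulI // [X in _ = cl X]mulgA [X in _ = X]right_cosetM //.
  rewrite eq_c -right_cosetM // -mulgA right_coset_mulI //.
  rewrite !(iterD (s + n)) -(coset_iterE (s + n) (iter j alpha h)) iter_gmulfM.
  rewrite (right_cosetM N_normal (iter (s + n) alpha (expgz z l2))).
  by rewrite coset_iter_fixed -right_cosetM.
rewrite !epsE; split; case=> l eq_l eq_cl; last first.
  by exists (l1 + l)%R; [lia | apply/eq_classes].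
exists (l - l1)%R; first by lia.
by apply/eq_classes; [lia | rewrite GRing.subrKC].
Qed.

Lemma eps_representative x i : exists c s, eps alpha N z k x (i, c, s).
Proof.
move: x => [[m g] n].
have le_mk : (m <= k * m)%N by apply: leq_pmull.
(* s = n + i - m modulo k, and adding k m makes s at least n, so that g can be
   shifted by alpha^(s - n). *)
pose s := (n + i + (k * m - m))%N.
exists (expgz z m%:Z * iter (s - n) alpha g), s; apply/epsE.
exists (- m%:Z)%R; first by rewrite /s; lia.
rewrite iter_gmulfM -iterD subnKC; last by rewrite /s; lia.
rewrite right_cosetM // right_cosetM // coset_iter_fixed -!right_cosetM //.
by rewrite expgzN mulKg.
Qed.

Lemma perfect_eps : perfect (eps alpha N z k).
Proof.
move=> x y; apply/seteqP; split=> w /=.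
  by case=> a xa [b yb <-]; apply/eps_mul2.
case: w => [[i f] j] xyw.
have [c [s xa]] := eps_representative x i.
have eq_w : ((i, c, s) : BR alpha) * ((s, c^-1 * f, j) : BR alpha) = (i, f, j).
  by rewrite /monoid.mul /= minnn addnK addKn subnn /= mulVKg.
exists (i, c, s) => //; exists (s, c^-1 * f, j) => //=.
by apply/(eps_mul2 _ _ xa); rewrite eq_w.
Qed.

(** By [coset_swap] the conjugate of x by z^-n is sent by alpha^(k n) into N x,
    and alpha^(k n) factors through alpha^n because k is positive. *)
Lemma iter_meets_coset n x : range (iter n alpha) `&` right_coset N x !=set0.
Proof.
have le_nk : (n <= k * n)%N by apply: leq_pmull.
pose g := z ^+ n * x / z ^+ n.
exists (iter (k * n) alpha g); split.
  by exists (iter (k * n - n) alpha g); rewrite // -iterD subnKC.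
apply/right_coset_eq => //; apply/(right_coset_mulI N_normal (z ^+ n)).
have := @coset_swap (k * n) 0 n%:Z g; rewrite /= => ->; last by lia.
by rewrite mulgVK.
Qed.

End GroupCongruence.

Theorem theorem4p10 (G : groupType) (alpha : endomorphism G)
    (N : set G) (z : G) (k : nat)
    (N_normal : normal_subgroup N)
    (N_invariant : invariant_subgroup alpha N)
    (k_ge1 : (1 <= k)%N)
    (Nz_alpha : right_coset N (alpha z) = right_coset N z)
    (Nz_conj : forall g : G,
       [set g^-1 * u * iter k alpha g | u in right_coset N z]
       = right_coset N z) :
  perfect (eps alpha N z k) <->
  (forall (n : nat) (x : G), (1 <= n)%N ->
     range (iter n alpha) `&` right_coset N x !=set0).
Proof.
split=> _ => [n x _|]; first exact: (iter_meets_coset N_normal k_ge1 Nz_conj).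
exact: perfect_eps.
Qed.
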